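(* Let $n_1,\ldots,n_k$ be positive integers and let $G=K_{n_1,\ldots,n_k}$. Put $\sigma_0=1$, $n=\sigma_1=\sum_{i=1}^k n_i$, and $\sigma_i=\sum_{1\leq j_1<\cdots<j_i\leq k} n_{j_1}\cdots n_{j_i}$ for $i=2,\ldots,k$. Then $$S_G(\lambda)=(\lambda +1)^{n-k} \Big(\lambda^k+(k-n)\lambda^{k-1}+\big(\tbinom{k}{2}-(k-1)n\big)\lambda^{k-2}+\sum_{m=3}^{k}\sum_{i=0}^{m}(-1)^{i-1}2^{i-1}\tbinom{k-i}{m-i}(i-2)\sigma_i\lambda^{k-m}\Big).$$
   Context: For a simple graph $G$ with adjacency matrix $A(G)$, the Seidel matrix is $S(G)=J-I-2A(G)$, where $I$ is the identity matrix and $J$ the all-ones matrix. The Seidel characteristic polynomial is $S_G(\lambda)=\det(\lambda I-S(G))$. The complete multipartite graph $K_{n_1,\ldots,n_k}$ has vertex set partitioned into parts of sizes $n_1,\ldots,n_k$, two vertices being adjacent iff they lie in different parts. *)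

(* Defs.v *)
From mathcomp Require Import all_boot all_order all_algebra.
Set Implicit Arguments.
Unset Strict Implicit.
Unset Printing Implicit Defensive.
Import GRing.Theory Num.Theory.
Local Open Scope ring_scope.

Record sgraph := SGraph {
  vertex : finType;
  adj : rel vertex;
  adj_sym : symmetric adj;
  adj_irrefl : irreflexive adj }.

(* Rows and columns are indexed through the library enumeration of the
   vertices; the characteristic polynomial does not depend on this choice. *)
Definition adjacency_mx (R : numFieldType) (G : sgraph) : 'M[R]_#|vertex G| :=
  \matrix_(i, j) (adj (enum_val i) (enum_val j))%:R.

Definition seidel_mx (R : numFieldType) (G : sgraph) : 'M[R]_#|vertex G| :=
  const_mx 1 - 1%:M - 2%:R *: adjacency_mx R G.

Definition seidel_poly (R : numFieldType) (G : sgraph) : {poly R} :=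
  char_poly (seidel_mx R G).

(* G is (a copy of) K_{n_1,...,n_k}; [part v] is the index of the part
   containing v, and parts are indexed from 0. *)
Definition complete_multipartite (k : nat) (n : 'I_k -> nat) (G : sgraph) :
    Prop :=
  exists part : vertex G -> 'I_k,
    (forall i : 'I_k, #|[set v | part v == i]| = n i) /\
    (forall u v : vertex G, adj u v = (part u != part v)).

(* An increasing tuple j_1 < ... < j_i is represented by the i-element set of
   its entries. *)
Definition sigma (k : nat) (n : 'I_k -> nat) (i : nat) : nat :=
  (\sum_(J : {set 'I_k} | #|J| == i) \prod_(j in J) n j)%N.

Lemma sigma0 (k : nat) (n : 'I_k -> nat) : sigma n 0 = 1%N.
Proof.
rewrite /sigma (big_pred1 set0) ?big_set0 // => J.
by rewrite cards_eq0.
Qed.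

Lemma sigma1 (k : nat) (n : 'I_k -> nat) :
  sigma n 1 = (\sum_(i < k) n i)%N.
Proof.
rewrite /sigma (eq_bigl (fun J => J \in [set [set x] | x : 'I_k])); last first.
  move=> J; apply/cards1P/imsetP => [[x ->]|[x _ ->]]; by exists x.
rewrite big_imset /=; last by move=> x y _ _; apply: set1_inj.
by apply: eq_bigr => i _; rewrite big_set1.
Qed.

Section CompleteMultipartite.
Variables (k : nat) (n : 'I_k -> nat).

Definition kmulti_adj : rel {i : 'I_k & 'I_(n i)} :=
  fun u v => tag u != tag v.

Lemma kmulti_sym : symmetric kmulti_adj.
Proof. by move=> u v; rewrite /kmulti_adj eq_sym. Qed.

Lemma kmulti_irrefl : irreflexive kmulti_adj.
Proof. by move=> u; rewrite /kmulti_adj eqxx. Qed.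

Definition kmulti : sgraph := SGraph kmulti_sym kmulti_irrefl.

Lemma kmultiP : complete_multipartite n kmulti.
Proof.
exists (fun u : {i : 'I_k & 'I_(n i)} => tag u); split=> // i.
have inj : injective (fun x : 'I_(n i) => Tagged (fun j => 'I_(n j)) x).
  by move=> x y /eqP; rewrite eq_Tagged => /eqP.
rewrite -[RHS]card_ord -(card_imset _ inj); apply: eq_card => u.
rewrite inE; apply/eqP/imsetP => [<-|[x _ ->] //].
by exists (tagged u); rewrite //; case: u.
Qed.

End CompleteMultipartite.

(* Main.v *)
Require Import Defs.
From mathcomp Require Import all_boot all_order all_algebra.
From mathcomp Require Import ring.
Set Implicit Arguments.
Unset Strict Implicit.
Unset Printing Implicit Defensive.
Import GRing.Theory Num.Theory.
Local Open Scope ring_scope.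

(* The Seidel matrix is S = P C P^T - I with P the vertex-part incidence matrix
   and C = 2I - J of order k.  Since det(xI - UV) and det(xI - VU) agree up to a
   power of x, for x = lambda + 1 the polynomial is x^(n-k) times the k x k
   determinant of diag(x - 2 n_i) plus a rank-one matrix, that is
   prod_i (x - 2 n_i) + sum_i n_i prod_(j != i) (x - 2 n_j).  Expanding over
   subsets of parts gives sum_i (-2)^(i-1) (i-2) sigma_i x^(k-i), and the
   binomial theorem for (lambda + 1)^(k-i) yields the stated coefficients. *)

Lemma det_scalar_sub_mulC (R : comNzRingType) (m k : nat) (x : R)
    (U : 'M[R]_(m, k)) (V : 'M[R]_(k, m)) :
  x ^+ k * \det (x%:M - U *m V) = x ^+ m * \det (x%:M - V *m U).
Proof.
(* Schur complements of M with respect to either diagonal block. *)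
pose M := block_mx x%:M U V 1%:M.
have detM : \det M = \det (x%:M - U *m V).
  have /(congr1 determinant) :
      M *m block_mx 1%:M 0 (- V) 1%:M = block_mx (x%:M - U *m V) U 0 1%:M.
    rewrite mulmx_block !mulmx1 !mulmx0 !mul1mx !add0r mulmxN subrr.
    by [].
  by rewrite det_mulmx det_lblock det_ublock !det1 !mulr1.
have /(congr1 determinant) :
    block_mx 1%:M 0 (- V) x%:M *m M = block_mx x%:M U 0 (x%:M - V *m U).
  rewrite mulmx_block !mul1mx !mul0mx !mulmx1 !addr0 mulNmx.
  by rewrite scalar_mxC mulNmx addNr addrC.
rewrite det_mulmx det_lblock det_ublock det1 mul1r !det_scalar detM.
by [].
Qed.

(** Matrix determinant lemma for the rank-one update [u *m v] of [D]. Clearing the lower left block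
    of the bordered matrix [M] by columns leaves [A]; clearing it by rows leaves [D] at the price of
    a factor [p], which cancels because every [a i] is nonzero. *)
Lemma det_diag_add_col (R : idomainType) (k : nat) (a c : 'I_k -> R) :
  (forall i, a i != 0) ->
  \det (\matrix_(i, j) (a i *+ (i == j) + c i)) =
  \prod_i a i + \sum_i c i * \prod_(j | j != i) a j.
Proof.
move=> a_neq0; set A := (X in \det X); set p := \prod_i a i.
have p_neq0 : p != 0 by apply/prodf_neq0.
pose D : 'M_k := diag_mx (\row_i a i).
pose u : 'cV_k := \col_i c i.
pose v : 'rV[R]_k := const_mx 1.
(* [w] and [p] are v *m \adj D and \det D, which avoids inverting D. *)
pose w : 'rV_k := \row_i \prod_(j | j != i) a j.
pose M := block_mx D u (- v) (1%:M : 'M_1).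
have detM : \det M = \det A.
  have /(congr1 determinant) :
      M *m block_mx 1%:M 0 v 1%:M = block_mx A u 0 1%:M.
    rewrite mulmx_block !mulmx1 !mulmx0 !mul1mx !add0r addNr.
    congr block_mx; apply/matrixP => i j.
    by rewrite !mxE big_ord1 !mxE mulr1.
  by rewrite det_mulmx det_lblock det_ublock !det1 !mulr1.
have /(congr1 determinant) :
    block_mx 1%:M 0 w p%:M *m M = block_mx D u 0 (w *m u + p%:M).
  rewrite mulmx_block !mul1mx !mul0mx !mulmx1 !addr0.
  congr block_mx; rewrite mulmxN mul_scalar_mx mul_mx_diag.
  apply/matrixP => i j; rewrite !mxE mulr1 /p [X in _ - X](bigD1 j) //= mulrC subrr.
  by [].
rewrite det_mulmx det_lblock det_ublock det1 mul1r det_scalar1 detM det_diag.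
under [X in _ = X * _]eq_bigr do rewrite mxE.
move/(mulfI p_neq0) ->; rewrite det_mx11 !mxE mulr1n addrC; congr (_ + _).
by apply: eq_bigr => i _; rewrite !mxE mulrC.
Qed.

Lemma prodr_const_notin (R : comNzRingType) (k : nat) (J : {set 'I_k}) (x : R) :
  \prod_(j | j \notin J) x = x ^+ (k - #|J|).
Proof.
rewrite prodr_const; congr (_ ^+ _).
by apply/(canRL (addKn _)); rewrite cardC card_ord.
Qed.

Lemma prod_addr_sets (R : comNzRingType) (k : nat) (y : 'I_k -> R) (x : R) :
  \prod_i (y i + x) = \sum_(J : {set 'I_k}) \prod_(j in J) y j * x ^+ (k - #|J|).
Proof.
rewrite bigA_distr; apply: eq_bigr => J _.
rewrite big_if /=; congr (_ * _).
by rewrite prodr_const_notin.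
Qed.

Lemma sum_prod_addr_sets (R : comNzRingType) (k : nat) (y : 'I_k -> R) (x : R) :
  \sum_i y i * \prod_(j | j != i) (y j + x) =
  \sum_(J : {set 'I_k}) #|J|%:R * (\prod_(j in J) y j * x ^+ (k - #|J|)).
Proof.
(* Dropping x from the i-th factor keeps exactly the subsets containing i. *)
transitivity (\sum_i \sum_(J : {set 'I_k} | i \in J)
                \prod_(j in J) y j * x ^+ (k - #|J|)).
  apply: eq_bigr => i _.
  have -> : y i * \prod_(j | j != i) (y j + x) =
            \prod_j (y j + (if j == i then 0 else x)).
    rewrite [RHS](bigD1 i) //= eqxx addr0; congr (_ * _).
    by apply: eq_bigr => j /negPf ->.
  rewrite bigA_distr [RHS]big_mkcond; apply: eq_bigr => J _.
  case: ifP => [iJ|/negbT iJ].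
    rewrite big_if /=; congr (_ * _).
    rewrite (eq_bigr (fun=> x)) => [|j jJ].
      by rewrite prodr_const_notin.
    by case: eqP jJ => // ->; rewrite iJ.
  by rewrite (bigD1 i) //= (negPf iJ) eqxx mul0r.
(* For fixed [J] the summand does not depend on [i], so summing over [i \in J] yields the factor
   [#|J|]. *)
rewrite (exchange_big_dep predT) //=; apply: eq_bigr => J _.
by rewrite sumr_const mulr_natl.
Qed.

Lemma sum_sigma (R : comNzRingType) (k : nat) (n : 'I_k -> nat) (F : nat -> R) :
  \sum_(J : {set 'I_k}) F #|J| * (\prod_(j in J) n j)%:R =
  \sum_(0 <= i < k.+1) F i * (sigma n i)%:R.
Proof.
(* Subsets are grouped by cardinality; [inord] is faithful because [#|J| <= k]. *)
rewrite big_mkord (partition_big (fun J : {set 'I_k} => inord #|J| : 'I_k.+1) predT) //=.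
apply: eq_bigr => i _; rewrite /sigma natr_sum mulr_sumr.
apply: eq_big => [J|J /eqP <-].
  rewrite -val_eqE /= inordK // ltnS -[X in (_ <= X)%N]card_ord.
  exact: max_card.
rewrite inordK // ltnS -[X in (_ <= X)%N]card_ord.
exact: max_card.
Qed.

Lemma sum_expand_binomial (R : comNzRingType) (k : nat) (c : nat -> R) :
  \sum_(0 <= i < k.+1) c i *: ('X + 1) ^+ (k - i) =
  \sum_(0 <= m < k.+1) \sum_(0 <= i < m.+1)
     (c i * 'C(k - i, m - i)%:R) *: 'X^(k - m).
Proof.
transitivity (\sum_(0 <= i < k.+1) \sum_(i <= m < k.+1)
     (c i * 'C(k - i, m - i)%:R) *: 'X^(k - m)).
  apply: eq_big_nat => i /andP[_ ltik].
  (* The shift m = i + j makes j = m - i the binomial summation index. *)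
  rewrite -{3}[i]add0n big_addn subSn //.
  rewrite big_mkord exprDn scaler_sumr; apply: eq_bigr => j _.
  by rewrite expr1n mulr1 -scaler_nat scalerA addnK addnC subnDA.
under eq_bigr => i _ do rewrite (big_nat_widenl _ 0) //=.
rewrite (exchange_big_dep_nat predT) //=; apply: eq_big_nat => m /andP[_ ltmk].
by rewrite [RHS](big_nat_widen _ _ k.+1).
Qed.

Lemma seidel_poly_multipartite_det (R : numFieldType) (k : nat) (n : 'I_k -> nat)
    (G : sgraph) :
  (forall i, 0 < n i)%N -> complete_multipartite n G ->
  let x : {poly R} := 'X + 1 in
  seidel_poly R G = x ^+ (\sum_(i < k) n i - k) *
    \det (\matrix_(i < k, j < k) ((x - (2 * n i)%:R) *+ (i == j) + (n i)%:R)).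
Proof.
move=> n_gt0 [part [card_part adjE]] x.
have part_fiber i : (\sum_(v | part v == i) 1 = n i)%N.
  by rewrite sum1dep_card card_part.
have cardG : #|vertex G| = (\sum_(i < k) n i)%N.
  rewrite -sum1_card (partition_big part predT) //=.
  by apply: eq_bigr => i _; rewrite part_fiber.
(* Since the parts are nonempty, the truncated difference in the exponent is exact. *)
have le_kN : (k <= \sum_(i < k) n i)%N.
  by rewrite -{1}[k]card_ord -sum1_card leq_sum.
pose P : 'M[{poly R}]_(_, k) := \matrix_(v < #|vertex G|, i < k) (part (enum_val v) == i)%:R.
pose C : 'M[{poly R}]_k := 2%:M - const_mx 1.
have PC v j : (P *m C) v j = 2 *+ (part (enum_val v) == j) - 1.
  rewrite mxE (bigD1 (part (enum_val v))) //= big1 => [|i /negPf neq].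
    by rewrite !mxE eqxx mul1r addr0.
  by rewrite !mxE eq_sym neq mul0r.
have -> : seidel_poly R G = \det (x%:M - (P *m C) *m P^T).
  congr (\det _); apply/matrixP => u v.
  rewrite !mxE (bigD1 (part (enum_val v))) //= big1 => [|i /negPf neq].
    rewrite PC !mxE adjE eqxx mulr1 addr0.
    have [->|neq] := eqVneq u v; rewrite ?eqxx /=.
      by rewrite /x; ring.
    by rewrite /x; case: (_ == _) => /=; ring.
  by rewrite !mxE eq_sym neq mulr0.
have x_neq0 : x != 0 by rewrite -size_poly_eq0 /x -polyC1 size_XaddC.
(* The factor [x ^+ k] is what [det_scalar_sub_mulC] needs to pass to order [k]. *)
apply: (mulfI (expf_neq0 k x_neq0)).
rewrite det_scalar_sub_mulC mulrA -exprD addnC subnK // -cardG.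
(* [P^T *m P] is diagonal with the part sizes as entries, so it scales row [i] of [C] by [n i]. *)
have -> : P^T *m (P *m C) = \matrix_(i, j) ((n i)%:R * (2 *+ (i == j) - 1)).
  apply/matrixP => i j; rewrite mxE [RHS]mxE -(part_fiber i) natr_sum mulr_suml.
  rewrite [RHS]big_mkcond (reindex _ (onW_bij _ (@enum_val_bij (vertex G)))) /=.
  apply: eq_bigr => v _; rewrite PC !mxE.
  by case: eqP => [->|_]; rewrite ?mul0r.
by congr (_ * \det _); apply/matrixP => i j; rewrite !mxE; case: (i == j); ring.
Qed.

Theorem theorem2p7 (R : numFieldType) (k : nat) (n : 'I_k -> nat) (G : sgraph)
    (hk : (0 < k)%N) (hn : forall i : 'I_k, (0 < n i)%N)
    (hG : complete_multipartite n G) :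
  let N := (\sum_(i < k) n i)%N in
  seidel_poly R G =
    ('X + 1) ^+ (N - k) *
    ('X^k + (k%:R - N%:R) *: 'X^(k - 1)
     + ('C(k, 2)%:R - (k%:R - 1) * N%:R) *: 'X^(k - 2)
     + \sum_(3 <= m < k.+1) \sum_(0 <= i < m.+1)
         ((-1) ^ (i%:Z - 1) * 2%:R ^ (i%:Z - 1) * 'C(k - i, m - i)%:R
          * (i%:R - 2%:R) * (sigma n i)%:R) *: 'X^(k - m)).
Proof.
move=> N; rewrite (seidel_poly_multipartite_det _ hn hG); congr (_ * _).
set x : {poly R} := 'X + 1.
pose y i : {poly R} := - (2 * n i)%:R.
(* Each diagonal entry [x - 2 n_i] is nonzero, being a polynomial of degree 1. *)
rewrite det_diag_add_col => [|i]; last first.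
  by rewrite -size_poly_eq0 /x -addrA -polyC1 -polyC_natr -polyCN -polyCD size_XaddC.
pose F i : R := (-1) ^ (i%:Z - 1) * 2 ^ (i%:Z - 1) * (i%:R - 2).
(* The integer exponent [i - 1] is negative at [i = 0]; pulling out the inverse of -2 leaves natural
   exponents. *)
have FE i : F i = - 2^-1 * (-2) ^+ i * (i%:R - 2).
  have N1 : (-1 : R) != 0 by rewrite oppr_eq0 oner_eq0.
  have N2 : (2 : R) != 0 by rewrite pnatr_eq0.
  rewrite /F !expfzDr // -!exprnP !exprN1 invrN invr1.
  by rewrite -[- 2]mulN1r exprMn; ring.
transitivity (\sum_(J : {set 'I_k})
  (F #|J| *: x ^+ (k - #|J|)) * (\prod_(j in J) n j)%:R).
  have neq0 : (- 2 : {poly R}) != 0 by rewrite oppr_eq0 -polyC_natr polyC_eq0 pnatr_eq0.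
  (* Multiplying by -2 turns the weights [n i] into [y i], so that [J] contributes [#|J| - 2] times
     its product of [y j] and its power of [x]. *)
  apply: (mulfI neq0).
  transitivity (- 2 * \prod_i (y i + x) + \sum_i y i * \prod_(j | j != i) (y j + x)).
    rewrite mulrDr mulr_sumr; congr (_ * _ + _).
      by apply: eq_bigr => i _; rewrite addrC.
    apply: eq_bigr => i _; rewrite mulrA /y natrM mulNr; congr (_ * _).
    by apply: eq_bigr => j _; rewrite natrM addrC.
  rewrite sum_prod_addr_sets prod_addr_sets !mulr_sumr -big_split /=.
  apply: eq_bigr => J _.
  have -> : \prod_(j in J) y j = (-2) ^+ #|J| * (\prod_(j in J) n j)%:R.
    rewrite natr_prod -prodr_const -big_split /=.
    by apply: eq_bigr => j _; rewrite /y natrM mulNr.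
  have half : 2 * (2^-1)%:P = 1 :> {poly R}.
    by rewrite -polyC_natr -polyCM mulfV ?pnatr_eq0.
  rewrite FE -mul_polyC !rmorphM /= rmorphXn /= rmorphB !rmorphN /= !polyC_natr.
  set h := (2^-1)%:P in half *; set p := (- 2) ^+ _.
  set z := x ^+ _; set q := (\prod_(j in J) n j)%:R.
  transitivity (2 * h * (#|J|%:R - 2) * p * q * z); last by ring.
  by rewrite half; ring.
rewrite (sum_sigma n (fun i => F i *: x ^+ (k - i))).
under eq_bigr => i _ do rewrite mulr_natr scalerMnl.
rewrite (sum_expand_binomial _ (fun i => F i *+ sigma n i)).
(* These values give the three leading coefficients; [F 2 = 0] is why [sigma n 2] is absent from the
   third. *)
have F0 : F 0 = 1 by rewrite FE; field; rewrite ?pnatr_eq0.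
have F1 : F 1 = - 1 by rewrite FE; field; rewrite ?pnatr_eq0.
have F2 : F 2 = 0 by rewrite FE subrr mulr0.
pose T m := \sum_(0 <= i < m.+1) (F i *+ sigma n i * 'C(k - i, m - i)%:R) *: 'X^(k - m).
have T0 : T 0 = 'X^k.
  by rewrite /T big_nat1 F0 sigma0 mulr1n subn0 bin0 mulr1 scale1r.
have T1 : T 1 = (k%:R - N%:R) *: 'X^(k - 1).
  rewrite /T big_nat_recr // big_nat1 /= F0 F1 sigma0 sigma1 -scalerDl.
  by rewrite !subn0 bin1 bin0 -mulr_natr; congr (_ *: _); ring.
have T2 : T 2 = ('C(k, 2)%:R - (k%:R - 1) * N%:R) *: 'X^(k - 2).
  rewrite /T 2?big_nat_recr // big_nat1 /= F0 F1 F2 sigma0 sigma1 -!scalerDl.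
  by rewrite !subn0 bin1 natrB // mul0rn -mulr_natr; congr (_ *: _); ring.
rewrite -/N -T1 -T2 -T0 -[LHS]/(\sum_(0 <= m < k.+1) T m).
rewrite [in LHS]big_ltn // [in LHS]big_ltn // addrA.
have -> : \sum_(2 <= m < k.+1) T m = T 2 + \sum_(3 <= m < k.+1) T m.
  (* For [k = 1] the sum on the left is empty, and [T 2], whose exponent [k - 2] truncates to 0, has
     zero coefficient. *)
  case: (ltnP 1 k) => [k_gt1|k_le1]; first by rewrite big_ltn.
  have k1 : k = 1%N by apply/eqP; rewrite eqn_leq k_le1.
  by rewrite T2 k1 !big_geq // subrr mul0r subr0 scale0r addr0.
rewrite addrA; congr (_ + _).
apply: eq_bigr => m _; apply: eq_bigr => i _.
by congr (_ *: _); rewrite -mulr_natr /F; ring.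
Qed.
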